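(* Let $(u_n)_{n\geq 0}$ be a non-degenerate Lucas sequence, $u_n=a_1u_{n-1}+a_2u_{n-2}$, with non-zero discriminant $\Delta_u=a_1^2+4a_2$. Then for every $\varepsilon>0$, $$\sum_{\substack{m>x \\ \gcd(m,a_2)=1}}\frac{1}{\ell_u(m)}\leq\exp\left(-\left(\frac{1}{\sqrt{6}}-\varepsilon+o(1)\right)\sqrt{(\log x)(\log \log x)}\right),$$ when $x$ is sufficiently large in terms of $\varepsilon$, where the $o(1)$ depends on $u$.
   Context: A Lucas sequence is a sequence of integers $(u_n)_{n\geq 0}$ with $u_0=0$, $u_1=1$ and $u_n=a_1u_{n-1}+a_2u_{n-2}$ for all $n\geq 2$, where $a_1,a_2\in\mathbb{Z}$ and $a_2\neq 0$. It is non-degenerate if no ratio $\alpha_i/\alpha_j$ ($i\neq j$) of pairwise distinct complex roots of the characteristic polynomial $X^2-a_1X-a_2$ is a root of unity. For each positive integer $m$ with $\gcd(m,a_2)=1$, the rank of appearance $z_u(m)$ is the smallest positive integer $n$ such that $m$ divides $u_n$ (it is well known to exist), and $\ell_u(m):=\operatorname{lcm}(m,z_u(m))$. The sum runs over positive integers $m>x$ coprime to $a_2$. The symbol $o(1)$ denotes a function of $x$ tending to $0$ as $x\to\infty$, where the function may depend on the sequence $u$. *)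

(* Defs.v *)
From mathcomp Require Import all_boot all_order all_algebra.
From mathcomp Require Import complex.
From mathcomp Require Import ring.
From mathcomp Require Import all_classical all_reals all_analysis.
Import Order.TTheory GRing.Theory Num.Theory numFieldNormedType.Exports.
Set Implicit Arguments.
Unset Strict Implicit.
Unset Printing Implicit Defensive.
Local Open Scope ring_scope.

Definition lucas_sequence (a1 a2 : int) (u : nat -> int) : Prop :=
  [/\ a2 != 0, u 0%N = 0, u 1%N = 1
    & forall n : nat, u n.+2 = a1 * u n.+1 + a2 * u n].

Definition lucas_discriminant (a1 a2 : int) : int := a1 ^+ 2 + 4 * a2.

Definition lucas_char_poly (K : nzRingType) (a1 a2 : int) : {poly K} :=
  'X^2 - (a1%:~R)%:P * 'X - (a2%:~R)%:P.

Definition is_root_of_unity (K : nzRingType) (z : K) : Prop :=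
  exists2 n : nat, (0 < n)%N & z ^+ n = 1.

Definition lucas_nondegenerate (R : realType) (a1 a2 : int) : Prop :=
  forall alpha beta : R[i],
    root (lucas_char_poly R[i] a1 a2) alpha -> root (lucas_char_poly R[i] a1 a2) beta ->
    alpha != beta -> ~ is_root_of_unity (alpha / beta).

(* The value 0 is a default, taken only when m divides no u n with n > 0;
   appearance_exists excludes this when m > 0 is coprime to a2. *)
Definition rank_of_appearance (u : nat -> int) (m : nat) : nat :=
  if pselect (exists n : nat, (0 < n)%N && (m%:Z %| u n)%Z) is left h
  then ex_minn h else 0%N.

Definition ell_u (u : nat -> int) (m : nat) : nat :=
  lcmn m (rank_of_appearance u m).

Lemma appearance_exists (a1 a2 : int) (u : nat -> int) (m : nat) :
  lucas_sequence a1 a2 u -> (0 < m)%N -> coprimez m%:Z a2 ->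
  exists n : nat, (0 < n)%N && (m%:Z %| u n)%Z.
Proof.
case: m => [//|m] [_ u0 _ uS] _ cop.
have desc (i d : nat) : (m.+1%:Z %| u (i + d)%N - u i)%Z ->
    (m.+1%:Z %| u (i + d).+1 - u i.+1)%Z -> (m.+1%:Z %| u d)%Z.
  elim: i => [|i IH] H1 H2; first by move: H1; rewrite add0n u0 subr0.
  apply: IH; last by rewrite -addSn.
  rewrite -(Gauss_dvdzr _ cop).
  have -> : a2 * (u (i + d)%N - u i) = (u (i + d).+2 - u i.+2)
      - a1 * (u (i + d).+1 - u i.+1).
    by rewrite !uS; ring.
  by rewrite rpredB // dvdz_mull.
pose g (i : 'I_(m.+1 * m.+1).+1) : 'I_m.+1 * 'I_m.+1 :=
  (inord `|(u i %% m.+1%:Z)%Z|, inord `|(u i.+1 %% m.+1%:Z)%Z|).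
have /injectivePn[i [j ij gij]] : ~~ injectiveb g.
  apply/negP => /injectiveP /leq_card.
  by rewrite card_prod !card_ord ltnn.
have modE (x y : int) : (inord `|(x %% m.+1%:Z)%Z| : 'I_m.+1) =
    inord `|(y %% m.+1%:Z)%Z| -> (m.+1%:Z %| x - y)%Z.
  have lt (z : int) : (`|(z %% m.+1%:Z)%Z| < m.+1)%N.
    by rewrite -ltz_nat gez0_abs ?modz_ge0 // ltz_pmod.
  move=> /(congr1 (@nat_of_ord _)); rewrite !inordK // => /(congr1 Posz).
  by rewrite !gez0_abs ?modz_ge0 // => /eqP; rewrite eqz_mod_dvd.
wlog lt_ij : i j ij gij / (i < j)%N.
  move=> W; case: (ltngtP i j) => [|ji|/val_inj E]; first exact: W.
    by apply: (W j i) => //; rewrite eq_sym.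
  by rewrite E eqxx in ij.
exists (j - i)%N; rewrite subn_gt0 lt_ij /=.
case: gij => /esym/modE H1 /esym/modE H2.
by apply: (desc i); rewrite subnKC // ltnW.
Qed.

(* Main.v *)
Require Import Defs.
From mathcomp Require Import all_boot all_order all_algebra.
From mathcomp Require Import complex.
From mathcomp Require Import ring lra zify.
From mathcomp Require Import all_classical all_reals all_analysis.
Import Order.TTheory GRing.Theory Num.Theory numFieldNormedType.Exports.
Local Open Scope classical_set_scope.
Local Open Scope ring_scope.

(** Write [L x = sqrt (ln x * ln (ln x))].  The estimate holds with room to
    spare: for [x] large in terms of [u] the sum is at most
    [exp (- 0.41 * L x)], and [0.41 > 1 / sqrt 6].  So [o] can be taken to vanish
    from some point on, and below that point it only has to absorb a constant.

    Put [y = exp (1.2 * L x)] and split the integers [m > x] by their largest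
    prime factor.

    - If all prime factors of [m] are at most [y], bound [1 / l_u(m)] by [1 / m].
      Rankin's trick with exponent [sg = ln (ln x) / (2.4 * L x)]
      (sum_smooth_tail_le) gives [exp (- (5 / 12) * L x)] up to a factor of at
      most [exp (0.005 * L x)].  It rests on a finite Euler product (sum_smooth_le) and on the weak
      Mertens bound [sum_(p <= n) ln p / p <= 2 ln n] (sum_ln_prime_le), which
      yields [sum_(p <= n) 1 / p <= C + d * ln n] for every [d > 0].

    - If the largest prime factor of [m] is [p > y], write [m = p * k] and
      [z = z_u(p)].  Then [z] divides [z_u(m)], and [p] does not divide [z] unless
      it divides the discriminant (rank_of_appearance_coprime, by the Frobenius
      map), so [l_u(m) >= lcm (p * k, z) = p * lcm (k, z)].  Summing over the [p]-smooth
      [k] costs [tau(z) / z] times a small power of [p], where [tau] counts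
      divisors and [tau(z) = O (z ^ (1 / 4))] (tau_le).  What remains is
      [y ^ (- 7 / 20) = exp (- 0.42 * L x)] times the sum over [p] of
      [p ^ (- 16 / 25) * tau(z_u(p)) / z_u(p)].  That sum converges
      (sum_prime_rank_le): either [z_u(p) ^ 2 > p], or [p] is one of the [O(n)]
      prime factors of the non-zero integer [u n] with [n = z_u(p) <= sqrt p]. *)

(** * Arithmetic of Lucas sequences *)

(** Any two roots of the characteristic polynomial in a ring, commuting or not,
    satisfy Binet's formula; it is used over the complex numbers and in matrices
    over ['F_p]. *)
Lemma lucas_binet {A : nzRingType} {a1 a2 : int} {u : nat -> int} (x y : A) :
  lucas_sequence a1 a2 u ->
  x ^+ 2 = x *~ a1 + a2%:~R -> y ^+ 2 = y *~ a1 + a2%:~R ->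
  forall n, x ^+ n - y ^+ n = (x - y) *~ u n.
Proof.
move=> [_ u0 u1 uS] xE yE n.
suff: x ^+ n - y ^+ n = (x - y) *~ u n /\
      x ^+ n.+1 - y ^+ n.+1 = (x - y) *~ u n.+1 by case.
elim: n => [|n [IH0 IH1]]; first by rewrite u0 u1 !expr0 !expr1 subrr.
split=> //.
have step (t : A) : t ^+ 2 = t *~ a1 + a2%:~R ->
    t ^+ n.+2 = (t ^+ n.+1) *~ a1 + (t ^+ n) *~ a2.
  by move=> tE; rewrite -addn2 exprD tE mulrDr mulrzAr -exprSr mulrzr.
rewrite (step x xE) (step y yE) uS mulrzDr [a1 * _]mulrC [a2 * _]mulrC !mulrzA.
by rewrite -IH0 -IH1 !mulrzBl; rewrite opprD addrACA.
Qed.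

Lemma lucas_addition {a1 a2 : int} {u : nat -> int} (m n : nat) :
  lucas_sequence a1 a2 u ->
  u (m + n).+1 = u m.+1 * u n.+1 + a2 * u m * u n.
Proof.
move=> [_ u0 u1 uS].
suff: u (m + n).+1 = u m.+1 * u n.+1 + a2 * u m * u n /\
      u (m + n).+2 = u m.+1 * u n.+2 + a2 * u m * u n.+1 by case.
elim: n => [|n [IH0 IH1]]; first by rewrite addn0 !uS u1 u0; split; ring.
by rewrite addnS; split=> //; rewrite uS IH0 IH1 !uS; ring.
Qed.

(** Consecutive terms have no common factor prime to [a2]. *)
Lemma lucas_consecutive {a1 a2 : int} {u : nat -> int} {p : nat} (n : nat) :
  lucas_sequence a1 a2 u -> (1 < p)%N -> coprimez p%:Z a2 ->
  (p%:Z %| u n)%Z -> ~~ (p%:Z %| u n.+1)%Z.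
Proof.
move=> [_ u0 u1 uS] p1 cop; elim: n => [|n IH] pn.
  by rewrite u1 dvdz1 /= neq_ltn p1 orbT.
apply/negP => pn1; move: (pn); apply/negP/IH.
by move: pn1; rewrite uS (rpredDl _ (dvdz_mull _ pn)) Gauss_dvdzr.
Qed.

Lemma rank_of_appearanceP {a1 a2 : int} {u : nat -> int} {m : nat} :
  lucas_sequence a1 a2 u -> (0 < m)%N -> coprimez m%:Z a2 ->
  [/\ (0 < rank_of_appearance u m)%N, (m%:Z %| u (rank_of_appearance u m))%Z
    & forall n, (0 < n)%N -> (m%:Z %| u n)%Z -> (rank_of_appearance u m <= n)%N].
Proof.
move=> Lu m0 cop; rewrite /rank_of_appearance.
case: pselect => [h|[]]; last exact: appearance_exists Lu m0 cop.
case: ex_minnP => n /andP[n0 mn] nmin; split=> // k k0 mk.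
by apply: nmin; rewrite k0.
Qed.

Lemma rank_of_appearance_dvd {a1 a2 : int} {u : nat -> int} {p : nat} :
  lucas_sequence a1 a2 u -> prime p -> coprimez p%:Z a2 ->
  forall n, (p%:Z %| u n)%Z -> (rank_of_appearance u p %| n)%N.
Proof.
move=> Lu pp cop n.
have [z0 pz zmin] := rank_of_appearanceP Lu (prime_gt0 pp) cop.
set z := rank_of_appearance u p in z0 pz zmin *.
have pz1 := lucas_consecutive _ Lu (prime_gt1 pp) cop pz.
have shift k : (p%:Z %| u (z + k)%N)%Z = (p%:Z %| u k)%Z.
  case: k => [|k]; first by rewrite addn0 pz; case: Lu => _ -> _ _; rewrite dvdz0.
  rewrite addnS (lucas_addition _ _ Lu).
  rewrite (rpredDr _ (dvdz_mulr _ (dvdz_mull _ pz))) Gauss_dvdzr //.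
  by rewrite coprimezE /= prime_coprime // -dvdzE.
have shiftn q k : (p%:Z %| u (q * z + k)%N)%Z = (p%:Z %| u k)%Z.
  by elim: q => [|q IH] //; rewrite mulSn -addnA shift.
rewrite {1}(divn_eq n z) shiftn => pr; rewrite /dvdn.
have [_ //|r0] := posnP (n %% z).
by have := zmin _ r0 pr; rewrite leqNgt ltn_mod z0.
Qed.

(** A companion matrix supplies a root of the characteristic polynomial. *)
Lemma lucas_root_in_matrices (F : comNzRingType) (a1 a2 : int) :
  exists x : 'M[F]_2, x ^+ 2 = x *~ a1 + a2%:~R.
Proof.
pose x : 'M[F]_2 := \matrix_(i, j)
  (if (i == 0) && (j == 0) then a1%:~R else if i == 0 then a2%:~R
   else (j == 0)%:R).
exists x.
have -> : x *~ a1 + a2%:~R = a1%:~R *: x + (a2%:~R)%:M.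
  by rewrite scaler_int; congr (_ + _); rewrite -(rmorph_int (@scalar_mx F 2)).
apply/matrixP => i j; rewrite expr2 -mulmxE !mxE !big_ord_recl big_ord0 !mxE /=.
case: i => [[|[|//]] ?]; case: j => [[|[|//]] ?]; rewrite /= ?eqE /=.
all: rewrite ?mulr1n ?mulr0n; ring.
Qed.

(** In a ring of characteristic [p] the commuting roots [x] and [y] satisfy
    [x ^ (p j) - y ^ (p j) = (x ^ j - y ^ j) ^ p], that is
    [u (p j) (x - y) = u j ^ p (x - y) ^ p]; and [(x - y) ^ 2] is the
    discriminant. *)
Lemma prime_dvd_lucas_mul {a1 a2 : int} {u : nat -> int} {p : nat} (j : nat) :
  lucas_sequence a1 a2 u -> prime p -> ~~ (p%:Z %| lucas_discriminant a1 a2)%Z ->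
  (p%:Z %| u (p * j)%N)%Z -> (p%:Z %| u j)%Z.
Proof.
move=> Lu pp pD puj.
have pchF : p \in [pchar 'F_p] := pchar_Fp pp.
have [x xE] := lucas_root_in_matrices 'F_p a1 a2.
pose y : 'M['F_p]_2 := a1%:~R - x.
have cxy : GRing.comm x y.
  by apply: commrB; [exact: commr_int | exact: commr_refl].
have yE : y ^+ 2 = y *~ a1 + a2%:~R.
  have -> : y ^+ 2 = y *~ a1 - x * y by rewrite expr2 {1}/y mulrBl mulrzl.
  by rewrite mulrBr -expr2 xE mulrzr opprB addrAC subrr add0r.
have pchM : p \in [pchar 'M['F_p]_2] by rewrite pchar_lalg.
have xyj n := lucas_binet x y Lu xE yE n.
have xy2 : (x - y) ^+ 2 = (lucas_discriminant a1 a2)%:~R.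
  have -> : x - y = x *+ 2 - a1%:~R by rewrite /y opprB addrA mulr2n.
  rewrite expr2 mulrBl !mulrBr !mulrzr !mulrzl !mulrnAl !mulrnAr -expr2 xE.
  rewrite -!mulrnA mulrnDl !pmulrn -!mulrzA.
  have -> : a1 * 4%:Z = 2 * a1 + 2 * a1 by ring.
  have cancel2 (V : zmodType) (X b c : V) : X + X + b - X - (X - c) = c + b.
    by rewrite opprB [X + X + b]addrAC addrK [X + b]addrC addrACA subrr addr0 addrC.
  rewrite mulrzDr cancel2 -mulrzDr; congr (1 *~ _).
  by rewrite /lucas_discriminant; ring.
have comm_pow : GRing.comm (x ^+ j) (y ^+ j).
  by apply: commrX; apply/commr_sym/commrX/commr_sym.
have Fr : (x ^+ j - y ^+ j) ^+ p = x ^+ (p * j) - y ^+ (p * j).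
  have := pFrobenius_autB_comm pchM comm_pow.
  by rewrite !pFrobenius_autE -!exprM ![(j * p)%N]mulnC.
have key : (lucas_discriminant a1 a2)%:~R ^+ p *~ (u j ^+ p.*2) = 0 :> 'M['F_p]_2.
  have E : ((x - y) ^+ p) *~ (u j ^+ p) = 0.
    rewrite -mulrzr rmorphXn -exprMn_comm; last exact: commr_int.
    rewrite mulrzr -xyj Fr xyj -mulrzr.
    have /eqP -> : (u (p * j)%N)%:~R == 0 :> 'M['F_p]_2 by rewrite -(dvdz_pcharf pchM).
    by rewrite mulr0.
  rewrite -addnn exprD mulrzA -xy2 -exprM mulnC exprM expr2.
  by rewrite -mulrzAl E mul0r mul0rz.
move/eqP: key; rewrite -mulrzr -rmorphXn -intrM -(dvdz_pcharf pchM).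
move: pD; rewrite !dvdzE /= abszM !abszX Euclid_dvdM // !Euclid_dvdX //.
by move=> /negbTE -> /= /andP[].
Qed.

(** By minimality of the rank [z]: if [p] divided [z], it would divide
    [u (z / p)]. *)
Lemma rank_of_appearance_coprime {a1 a2 : int} {u : nat -> int} {p : nat} :
  lucas_sequence a1 a2 u -> prime p -> coprimez p%:Z a2 ->
  ~~ (p%:Z %| lucas_discriminant a1 a2)%Z -> ~~ (p %| rank_of_appearance u p)%N.
Proof.
move=> Lu pp cop pD; apply/negP => /dvdnP[j zE].
have [z0 pz zmin] := rank_of_appearanceP Lu (prime_gt0 pp) cop.
have j0 : (0 < j)%N by move: z0; rewrite zE; case: (j).
have /(zmin _ j0) : (p%:Z %| u j)%Z.
  by apply: (prime_dvd_lucas_mul _ Lu pp pD); rewrite mulnC -zE.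
by rewrite zE leqNgt ltn_Pmulr ?prime_gt1.
Qed.

Lemma ell_u_ge_lcm {a1 a2 : int} {u : nat -> int} {p m : nat} :
  lucas_sequence a1 a2 u -> prime p -> (0 < m)%N -> (p %| m)%N ->
  coprimez m%:Z a2 -> (lcmn m (rank_of_appearance u p) <= ell_u u m)%N.
Proof.
move=> Lu pp m0 pm cop; have [z0 mz _] := rank_of_appearanceP Lu m0 cop.
apply: dvdn_leq; first by rewrite lcmn_gt0 m0 z0.
rewrite dvdn_lcm dvdn_lcml /=; apply: dvdn_trans (dvdn_lcmr _ _).
apply: (rank_of_appearance_dvd Lu pp).
  by move: cop; rewrite !coprimezE; apply: coprime_dvdl.
by apply: dvdz_trans mz; rewrite dvdzE.
Qed.

Lemma lucas_term_le {a1 a2 : int} {u : nat -> int} :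
  lucas_sequence a1 a2 u -> exists B : nat, forall n, (`|u n| <= 2 ^ (B * n))%N.
Proof.
move=> [_ u0 u1 uS]; pose K := (`|a1| + `|a2|)%N.
exists K => n.
suff: (`|u n| <= 2 ^ (K * n))%N && (`|u n.+1| <= 2 ^ (K * n.+1))%N by case/andP.
elim: n => [|n /andP[IH0 IH1]]; first by rewrite u0 u1 muln1 expn_gt0.
rewrite IH1 /= uS.
have K_le : (K <= 2 ^ K)%N by rewrite ltnW // ltn_expl.
rewrite -lez_nat; apply: le_trans (_ : (`|a1| * `|u n.+1| + `|a2| * `|u n|)%N%:Z <= _).
  by rewrite PoszD !PoszM !abszE (le_trans (ler_normD _ _)) // !normrM.
rewrite lez_nat [X in (_ <= 2 ^ X)%N]mulnS expnD.
apply: leq_trans (leq_mul K_le (leqnn _)); rewrite mulnDl.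
rewrite leq_add // leq_mul //.
by apply: leq_trans IH0 _; rewrite leq_pexp2l // leq_mul2l leqnSn orbT.
Qed.

(** Non-degeneracy makes every term of positive index non-zero. *)
Lemma lucas_term_neq0 {R : realType} {a1 a2 : int} {u : nat -> int} (n : nat) :
  lucas_sequence a1 a2 u -> lucas_nondegenerate R a1 a2 ->
  lucas_discriminant a1 a2 != 0 -> (0 < n)%N -> u n != 0.
Proof.
move=> Lu nd D0 n0.
pose s : R[i] := sqrtC (lucas_discriminant a1 a2)%:~R.
have sE : s ^+ 2 = a1%:~R ^+ 2 + 4 * a2%:~R.
  by rewrite sqrtCK /lucas_discriminant rmorphD rmorphM rmorphXn.
pose x : R[i] := (a1%:~R + s) / 2.
pose y : R[i] := (a1%:~R - s) / 2.
have xE : x ^+ 2 = x *~ a1 + a2%:~R.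
  have -> : a2%:~R = (s ^+ 2 - a1%:~R ^+ 2) / 4 :> R[i] by rewrite sE; field.
  by rewrite -mulrzr /x; field.
have yE : y ^+ 2 = y *~ a1 + a2%:~R.
  have -> : a2%:~R = (s ^+ 2 - a1%:~R ^+ 2) / 4 :> R[i] by rewrite sE; field.
  by rewrite -mulrzr /y; field.
have root_of (t : R[i]) : t ^+ 2 = t *~ a1 + a2%:~R ->
    root (lucas_char_poly R[i] a1 a2) t.
  by move=> tE; rewrite /root /lucas_char_poly !hornerE /= tE -mulrzr; apply/eqP; ring.
have xy : x - y = s by rewrite /x /y; field.
have s0 : s != 0 by rewrite sqrtC_eq0 intr_eq0.
have xyD : x != y by rewrite -subr_eq0 xy.
have y0 : y != 0.
  apply/eqP => y0; move: yE; rewrite y0 expr0n mul0rz add0r => /esym/eqP.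
  by rewrite intr_eq0; case: Lu => /negbTE ->.
apply/eqP => un0; apply: (nd x y) => //; [exact: root_of | exact: root_of |].
exists n => //; rewrite expr_div_n; have /eqP := lucas_binet x y Lu xE yE n.
by rewrite un0 mulr0z subr_eq0 => /eqP ->; rewrite divff // expf_neq0.
Qed.

(** * Divisors and prime factors *)

Lemma expn2_size_primes (m : nat) : (0 < m)%N -> (2 ^ size (primes m) <= m)%N.
Proof.
move=> m0; rewrite [X in (_ <= X)%N](prod_prime_decomp m0) /primes size_map.
have : forall f, f \in prime_decomp m -> (2 <= f.1 ^ f.2)%N.
  case=> p e /mem_prime_decomp[pp e0 _] /=.
  by rewrite (leq_trans (prime_gt1 pp)) // -{1}[p]expn1 leq_pexp2l // prime_gt0.
elim: (prime_decomp m) => [|f l IH] H; first by rewrite big_nil.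
rewrite big_cons /= expnS leq_mul ?H ?mem_head // IH // => g gl.
by rewrite H // inE gl orbT.
Qed.

(** The number of divisors of [n]. *)
Definition tau (n : nat) : nat := size (divisors n).

Lemma tau_prime_mul (p n : nat) :
  prime p -> (0 < n)%N -> (tau (p * n) <= 2 * tau n)%N.
Proof.
move=> pp n0; have pn0 : (0 < p * n)%N by rewrite muln_gt0 prime_gt0.
rewrite mul2n -addnn /tau -[X in (_ <= _ + X)%N](size_map (muln p)) -size_cat.
apply: uniq_leq_size (divisors_uniq _) _ => d.
rewrite mem_cat -!dvdn_divisors // => dpn.
case: (boolP (p %| d)%N) => [/dvdnP[e dE]|pd].
  apply/orP; right; apply/mapP; exists e; last by rewrite dE mulnC.
  by rewrite -dvdn_divisors //; move: dpn; rewrite dE mulnC dvdn_pmul2l ?prime_gt0.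
by rewrite -(@Gauss_dvdr d p) ?dpn // coprime_sym prime_coprime.
Qed.

Lemma tau_prime_exp_mul (p e n : nat) :
  prime p -> (0 < n)%N -> (tau (p ^ e * n) <= e.+1 * tau n)%N.
Proof.
move=> pp n0; have pn0 : (0 < p ^ e * n)%N by rewrite muln_gt0 expn_gt0 prime_gt0.
pose s := [seq (p ^ i * d)%N | i <- iota 0 e.+1, d <- divisors n].
have <- : size s = (e.+1 * tau n)%N by rewrite size_allpairs size_iota.
apply: uniq_leq_size (divisors_uniq _) _ => d.
rewrite -dvdn_divisors // => dpn.
have d0 : (0 < d)%N := dvdn_gt0 pn0 dpn.
have pe0 : (0 < p ^ e)%N by rewrite expn_gt0 prime_gt0.
have g0 : (0 < gcdn d (p ^ e))%N by rewrite gcdn_gt0 d0.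
have /(dvdn_pfactor _ _ pp)[i ie gE] := dvdn_gcdr d (p ^ e).
have /dvdnP[d' dE] := dvdn_gcdl d (p ^ e).
have /dvdnP[q qE] := dvdn_gcdr d (p ^ e).
apply/allpairsP; exists (i, d'); split; first by rewrite mem_iota.
  rewrite -dvdn_divisors //.
  have cop : coprime d' q.
    rewrite /coprime -(eqn_pmul2r g0) mul1n muln_gcdl -dE.
    by rewrite -qE.
  rewrite -(Gauss_dvdr _ cop) -(dvdn_pmul2r g0) -dE mulnAC.
  by rewrite -qE.
by rewrite mulnC -gE.
Qed.

(** Without prime factors below [16], [tau n ^ 4 <= n]: removing a prime factor
    at most halves [tau] and divides [n] by at least [2 ^ 4]. *)
Lemma tau_rough_le (n : nat) :
  [pred q | (16 <= q)%N].-nat n -> (tau n ^ 4 <= n)%N.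
Proof.
elim/ltn_ind: n => n IH rn; have n0 : (0 < n)%N by case/andP: rn.
have [n1|n1] := leqP n 1; first by have -> : n = 1%N by case: n n0 n1 {IH rn} => [|[]].
have pp := pdiv_prime n1; set p := pdiv n in pp.
have /dvdnP[m nE] := pdiv_dvd n; rewrite -/p mulnC in nE.
have m0 : (0 < m)%N by case: m nE n0 => // ->; rewrite muln0.
move: rn; rewrite nE pnatM pnatE // => /andP[/= p16 rm].
apply: leq_trans (_ : (2 * tau m) ^ 4 <= _)%N; first by rewrite leq_exp2r // tau_prime_mul.
by rewrite expnMn leq_mul // IH // nE ltn_Pmull ?prime_gt1.
Qed.

Lemma succ_exp4_le (e : nat) : (e.+1 ^ 4 <= 41 * 2 ^ e)%N.
Proof.
have [|e6] := leqP e 6; first by case: e => [|[|[|[|[|[|[|]]]]]]].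
elim: e e6 => // e IH; rewrite ltnS leq_eqVlt => /orP[/eqP <- //|e6].
(* From e.+1 >= 7 on, e.+2 / e.+1 <= 8 / 7, and (8 / 7) ^ 4 <= 2. *)
rewrite -(@leq_pmul2l (7 ^ 4)) // -expnMn.
apply: (@leq_trans (8 ^ 4 * e.+1 ^ 4)%N).
  by rewrite -expnMn leq_exp2r //; lia.
apply: (@leq_trans (7 ^ 4 * 2 * e.+1 ^ 4)%N); first by rewrite leq_mul2r orbT.
by rewrite -mulnA leq_mul2l [(2 ^ e.+1)%N]expnS [(41 * _)%N]mulnCA leq_mul2l IH ?orbT.
Qed.

(** The divisor bound [tau n = O (n ^ (1 / 4))]. *)
Lemma tau_le : exists C : nat, forall n, (0 < n)%N -> (tau n ^ 4 <= C * n)%N.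
Proof.
(* Bring in the primes below 16 one at a time: each costs a factor 41, by
   succ_exp4_le. *)
suff H B k : (B + k = 16)%N -> exists C : nat, forall n,
    [pred q | (B <= q)%N].-nat n -> (tau n ^ 4 <= C * n)%N.
  have [|C HC] := H 0%N 16%N; first by [].
  by exists C => n n0; apply: HC; rewrite /pnat n0; apply/allP.
elim: k B => [|k IH] B Bk.
  by exists 1%N => n; rewrite -(addn0 B) Bk mul1n; apply: tau_rough_le.
have [|C HC] := IH B.+1; first by rewrite addSnnS.
exists (41 * C)%N => n rn; have n0 : (0 < n)%N by case/andP: rn.
have C41 m : (C * m <= 41 * C * m)%N by rewrite -mulnA leq_pmull.
have [pB|pB] := boolP (prime B); last first.
  apply: leq_trans (HC _ _) (C41 _); apply: sub_in_pnat rn => q.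
  rewrite !inE => qn; rewrite leq_eqVlt => /orP[/eqP BE|//].
  by move: pB qn; rewrite BE mem_primes => /negbTE ->.
have [m cop nE] := pfactor_coprime pB n0.
move: (logn B n) nE => e nE.
have m0 : (0 < m)%N by case: m nE n0 {cop} => // ->.
have rm : [pred q | (B < q)%N].-nat m.
  move: rn; rewrite nE pnatM => /andP[rm _]; apply: sub_in_pnat rm => q.
  rewrite !inE => qm; rewrite leq_eqVlt => /orP[/eqP BE|//].
  by move: cop qm; rewrite BE prime_coprime -?BE // mem_primes => /negbTE ->; rewrite !andbF.
rewrite nE mulnC; apply: leq_trans (_ : (e.+1 * tau m) ^ 4 <= _)%N.
  by rewrite leq_exp2r // tau_prime_exp_mul.
have Be : (2 ^ e <= B ^ e)%N by case: (e) => // e1; rewrite leq_exp2r // prime_gt1.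
rewrite expnMn (leq_trans (leq_mul (succ_exp4_le e) (HC _ rm))) //.
by rewrite mulnACA leq_mul2l leq_mul2r Be !orbT.
Qed.

(** * Sums over integers and over primes *)

(** Comparison of two sums of which the second, over possibly more indices, has
    nonnegative terms dominating those of the first along an injection. *)
Lemma ler_sum_inj {R : numDomainType} {I J : finType} (h : I -> J)
    (P : pred I) (Q : pred J) (F : I -> R) (G : J -> R) :
  {in P &, injective h} -> (forall i, P i -> Q (h i) && (F i <= G (h i))) ->
  (forall j, Q j -> 0 <= G j) ->
  \sum_(i | P i) F i <= \sum_(j | Q j) G j.
Proof.
move=> hinj hP G0.
apply: (@le_trans _ _ (\sum_(i in P) G (h i))).
  by apply: ler_sum => i /hP/andP[].
rewrite -(big_imset G hinj) /=; set A := (h @: P)%SET.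
have AQ j : j \in A -> Q j by case/finset.imsetP => i iP ->; case/andP: (hP i iP).
rewrite [leRHS](bigID (mem A)) /= (eq_bigl (fun j => Q j && (j \in A))) /=.
  by rewrite lerDl sumr_ge0 // => j /andP[/G0].
by move=> j; case: (boolP (j \in A)) => [/AQ ->|]; rewrite ?andbF.
Qed.

Lemma ler_sum_dvd {R : numDomainType} (N d : nat) (P : pred nat) (g : nat -> R) :
  (0 < d)%N -> (forall m, 0 <= g m) ->
  \sum_(m < N | (d %| m)%N && P m) g m <= \sum_(k < N | P (d * k)%N) g (d * k)%N.
Proof.
move=> d0 g0.
have lt (m : 'I_N) : (m %/ d < N)%N by rewrite (leq_ltn_trans (leq_div _ _)).
apply: (@ler_sum_inj _ _ _ (fun m => Ordinal (lt m))) => //=.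
  move=> m n /andP[dm _] /andP[dn _] /(congr1 val) /= mn.
  by apply/val_inj; rewrite /= -(divnK dm) -(divnK dn) mn.
by move=> m /andP[dm Pm]; rewrite mulnC divnK // Pm /=.
Qed.

Lemma powR_natM {R : realType} (m n : nat) (s : R) :
  (m * n)%:R `^ s = m%:R `^ s * n%:R `^ s.
Proof. by rewrite natrM powRM. Qed.

Lemma sum_powR_le {R : realType} (a : R) (N : nat) : 0 < a ->
  \sum_(n < N | (0 < n)%N) n%:R `^ (- (1 + a)) <= 1 + a^-1.
Proof.
move=> a0.
(* Telescoping: a * n ^ (- 1 - a) <= (n - 1) ^ (- a) - n ^ (- a). *)
suff H : \sum_(n < N.+2 | (0 < n)%N) n%:R `^ (- (1 + a)) <=
    1 + a^-1 * (1 - N.+1%:R `^ (- a)).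
  apply: (@le_trans _ _ (\sum_(n < N.+2 | (0 < n)%N) n%:R `^ (- (1 + a)))).
    rewrite big_mkcond [leRHS]big_mkcond 2!big_ord_recr /= !ler_wpDr ?powR_ge0 //.
    by case: ifP => _; rewrite ?powR_ge0.
  apply: le_trans H _; rewrite lerD2l ler_piMr ?invr_ge0 ?(ltW a0) ?gerBl ?powR_ge0 //.
elim: N => [|N IH].
  rewrite big_mkcond !big_ord_recr big_ord0 /= !powR1; lra.
rewrite big_mkcond big_ord_recr /=; rewrite big_mkcond in IH.
apply: le_trans (lerD IH (lexx _)) _; rewrite -addrA lerD2l -lerBrDl -mulrBr.
have n0 : 0 < N.+1%:R :> R by rewrite ltr0n.
have m0 : 0 < N.+2%:R :> R by rewrite ltr0n.
set W := N.+2%:R `^ (- a); set r : R := N.+2%:R / N.+1%:R.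
have r0 : 0 < r by rewrite divr_gt0.
have -> : N.+1%:R `^ (- a) = W * r `^ a.
  have -> : W = (N.+1%:R * r) `^ (- a) by rewrite mulrC divfK // gt_eqF.
  by rewrite powRM ?ltW // -mulrA powRN [r `^ _]powRN mulVf ?mulr1 // gt_eqF ?powR_gt0.
have -> : N.+2%:R `^ (- (1 + a)) = W / N.+2%:R.
  by rewrite opprD addrC powRD ?(gt_eqF m0) ?implybT // powR_inv1 ?ltW.
have -> : 1 - W - (1 - W * r `^ a) = W * (r `^ a - 1) by ring.
rewrite mulrCA ler_pM2l ?powR_gt0 // ler_pdivlMl //.
rewrite lerBrDl; apply: (@le_trans _ _ (1 + a * ln r)); last first.
  by rewrite /powR gt_eqF // expR_ge1Dx.
rewrite lerD2l ler_pM2l // -[leRHS]opprK -lnV ?posrE // lerNr.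
have -> : r^-1 = 1 + - N.+2%:R^-1.
  have E : N.+1%:R = N.+2%:R - 1 :> R by rewrite -[N.+2%:R]natr1 addrK.
  by rewrite /r invf_div {1}E mulrBl divff ?gt_eqF // mul1r.
apply: le_ln1Dx; rewrite ltrN2 invf_lt1 // ltr1n //.
Qed.

(** [smooth Y m]: the integer [m] is positive and its prime factors are at most
    [Y]. *)
Definition smooth (Y : nat) : pred nat := [pred q | (q <= Y)%N : bool].-nat.

Lemma smooth_dvdM (Y d m : nat) : smooth Y (d * m)%N -> smooth Y m.
Proof. by rewrite /smooth pnatM => /andP[]. Qed.

Lemma smoothS (Y m : nat) : smooth Y.+1 m ->
  ~~ prime Y.+1 \/ ~~ (Y.+1 %| m)%N -> smooth Y m.
Proof.
move=> sm H; apply: sub_in_pnat sm => q; rewrite !inE => qm.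
rewrite leq_eqVlt => /orP[/eqP qE|//]; exfalso.
move: qm; rewrite qE mem_primes => /and3P[pq _ qm].
by case: H; [rewrite pq | rewrite qm].
Qed.

Lemma smooth0 (m : nat) : smooth 0 m -> m = 1%N.
Proof.
move=> sm; have m0 : (0 < m)%N by case/andP: sm.
case: m m0 sm => [//|[//|m]] _ /andP[_ /allP/(_ (pdiv m.+2))].
rewrite mem_primes pdiv_prime // pdiv_dvd /= => /(_ isT).
by rewrite inE leqNgt prime_gt0 // pdiv_prime.
Qed.

Lemma prime_powR_le {R : realType} (q : nat) (s : R) :
  prime q -> 1 / 2 <= s -> q%:R `^ (- s) <= 3 / 4.
Proof.
move=> pq s2; apply: (@le_trans _ _ (2 `^ (- (1 / 2)))); last first.
  rewrite powRN div1r powR12_sqrt //.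
  have h : 4 / 3 <= Num.sqrt (2 : R).
    by rewrite -(@ler_pXn2r _ 2) ?nnegrE ?sqrtr_ge0 // ?sqr_sqrtr //; lra.
  by apply: le_trans (_ : (4 / 3)^-1 <= _); [rewrite lef_pV2 ?posrE //; lra | lra].
have q1 : 2 <= q%:R :> R by rewrite ler_nat prime_gt1.
apply: (@le_trans _ _ (q%:R `^ (- (1 / 2)))).
  by apply: ler_powR; lra.
rewrite !powRN lef_pV2 ?posrE ?powR_gt0 ?ltr0n ?prime_gt0 //.
by apply: ge0_ler_powR; rewrite ?nnegrE //; lra.
Qed.

(** A finite form of Euler's product: the factor at [q] is bounded by splitting
    off the multiples of [q], and [(1 - t)^-1 <= exp (4 t)] for [t <= 3 / 4]. *)
Lemma sum_smooth_le {R : realType} (s : R) (N Y : nat) : 1 / 2 <= s ->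
  \sum_(m < N | smooth Y m) m%:R `^ (- s) <=
  expR (4 * \sum_(q < Y.+1 | prime q) q%:R `^ (- s)).
Proof.
move=> s2; elim: Y => [|Y IH].
  rewrite [X in 4 * X]big1 => [|[[|[|q]] //]]; rewrite mulr0 expR0.
  apply: (@le_trans _ _ (\sum_(m < 1) 1)); last by rewrite big_ord1.
  apply: (@ler_sum_inj _ _ _ (fun=> ord0)) => //.
    by move=> m n /smooth0 m1 /smooth0 n1 _; apply/val_inj; rewrite /= m1 n1.
  by move=> m /smooth0 ->; rewrite powR1 /=.
rewrite [X in 4 * X]big_mkcond big_ord_recr /= -big_mkcond /=.
have [pY|pY] := boolP (prime Y.+1); last first.
  rewrite addr0; apply: le_trans IH; rewrite le_eqVlt; apply/orP; left; apply/eqP.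
  apply: eq_bigl => m; apply/idP/idP => [sm|]; first by apply: smoothS sm _; left.
  by apply: sub_in_pnat => q _; rewrite !inE => /leqW.
set t := Y.+1%:R `^ (- s); set S := \sum_(m < N | smooth Y.+1 m) _.
have t34 : t <= 3 / 4 by apply: prime_powR_le.
have t0 : 0 <= t by apply: powR_ge0.
have S0 : 0 <= S by apply: sumr_ge0 => m _; apply: powR_ge0.
have rec : S <= t * S + \sum_(m < N | smooth Y m) m%:R `^ (- s).
  rewrite {1}/S (bigID (fun m : 'I_N => (Y.+1 %| m)%N)) /= lerD //.
    rewrite (eq_bigl (fun m : 'I_N => (Y.+1 %| m)%N && smooth Y.+1 m)); last first.
      by move=> m; rewrite andbC.
    apply: le_trans (ler_sum_dvd _ _ _ (fun m => m%:R `^ (- s)) _ _) _ => //.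
    rewrite mulr_sumr [leLHS]big_mkcond [leRHS]big_mkcond; apply: ler_sum => m _ /=.
    case: ifP => [/smooth_dvdM ->|_]; first by rewrite powR_natM.
    by case: ifP => // _; rewrite mulr_ge0 ?powR_ge0.
  rewrite [leLHS]big_mkcond [leRHS]big_mkcond; apply: ler_sum => m _ /=.
  case: ifP => [/andP[sm nm]|_]; first by rewrite (smoothS _ _ sm) //; right.
  by case: ifP => // _; rewrite powR_ge0.
have E1 : (1 - t) * S <= expR (4 * \sum_(q < Y.+1 | prime q) q%:R `^ (- s)).
  by apply: le_trans IH; rewrite mulrBl mul1r lerBlDl.
have E2 : 1 <= (1 - t) * expR (4 * t).
  apply: (@le_trans _ _ ((1 - t) * (1 + 4 * t))); first by nra.
  by rewrite ler_wpM2l ?expR_ge1Dx //; lra.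
rewrite mulrDr expRD.
apply: (@le_trans _ _ ((1 - t) * expR (4 * t) * S)); first by rewrite ler_peMl.
by rewrite mulrAC ler_wpM2r ?expR_ge0.
Qed.

(** The power of [p] in [n!] is at least [n %/ p >= n / (2 p)]; comparing with
    [n! <= n ^ n] gives a weak form of Mertens' first theorem. *)
Lemma sum_ln_prime_le {R : realType} (n : nat) : (0 < n)%N ->
  \sum_(p < n.+1 | prime p) ln (p%:R : R) / p%:R <= 2 * ln n%:R.
Proof.
move=> n0; have n0R : 0 < n%:R :> R by rewrite ltr0n.
have prod_le : (\prod_(p < n.+1 | prime p) p ^ (n %/ p) <= n ^ n)%N.
  have fact0 := fact_gt0 n.
  apply: (@leq_trans n`!); last first.
    elim: (n) => // k IH; rewrite factS expnS leq_mul //.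
    by apply: leq_trans IH _; case: (k) => // j; rewrite leq_exp2r.
  rewrite -[leqRHS](partnT fact0) (widen_partn _ (leqnn _)).
  have le : (n.+1 <= n`!.+1)%N.
    by rewrite ltnS; case: (n) => // k; rewrite factS leq_pmulr ?fact_gt0.
  rewrite (big_cat_nat _ le) //= big_mkord -[leqLHS]muln1 leq_mul //; last first.
    apply: (@leq_trans (\prod_(n.+1 <= i < n`!.+1) 1)%N); first by rewrite big1_eq.
    rewrite !big_seq; apply: leq_prod => p; rewrite mem_index_iota => /andP[np _].
    by rewrite expn_gt0 (leq_trans _ np).
  rewrite [leqLHS]big_mkcond [leqRHS]big_mkcond; apply: leq_prod => p _ /=.
  case: ifP => pp; last first.
    by case: (p : nat) => [|k]; rewrite ?logn0 // expn_gt0.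
  rewrite leq_pexp2l ?prime_gt0 // logn_fact //.
  by rewrite (big_ltn (m := 1)) ?expn1 ?leq_addr.
have ln_prod : \sum_(p < n.+1 | prime p) (n %/ p)%:R * ln (p%:R : R) <= n%:R * ln n%:R.
  have lnprod (N : nat) : ln (\prod_(p < N | prime p) p ^ (n %/ p))%N%:R =
      \sum_(p < N | prime p) (n %/ p)%:R * ln (p%:R : R) /\
      (0 < \prod_(p < N | prime p) p ^ (n %/ p))%N.
    elim: N => [|N [IH1 IH2]]; first by rewrite !big_ord0 ln1.
    rewrite big_mkcond [X in _ = X /\ _]big_mkcond !big_ord_recr /=.
    rewrite -!big_mkcond /=; case: ifP => pp; last by rewrite muln1 addr0.
    have pe0 : (0 < N ^ (n %/ N))%N by rewrite expn_gt0 prime_gt0.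
    split; last by rewrite muln_gt0 IH2.
    rewrite natrM lnM ?posrE ?ltr0n // IH1 natrX lnXn ?ltr0n ?prime_gt0 //.
    by rewrite mulr_natl.
  have [<- P0] := lnprod n.+1.
  rewrite mulr_natl -lnXn // -natrX ler_ln ?posrE ?ltr0n ?expn_gt0 ?n0 //.
  by rewrite ler_nat.
rewrite -(ler_pM2l n0R) mulrCA; apply: le_trans (_ : 2 * (n%:R * ln n%:R) <= _); last first.
  by rewrite mulrCA.
apply: le_trans (ler_wpM2l _ ln_prod) => //; rewrite !mulr_sumr.
apply: ler_sum => p pp; have p0 := prime_gt0 pp.
have lnp : 0 <= ln (p%:R : R) by rewrite ln_ge0 // ler1n.
rewrite [ln _ / _]mulrC !mulrA ler_wpM2r // ler_pdivrMr ?ltr0n //.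
rewrite -!natrM ler_nat.
have pn : (p <= n)%N by rewrite -ltnS.
have := divn_eq n p; have := ltn_mod n p; rewrite p0 => r_lt nE.
have : (1 <= n %/ p)%N by rewrite divn_gt0.
nia.
Qed.

(** The exponential lies below its chord on [[0, T]]. *)
Lemma expR_chord_le {R : realType} (t T : R) : 0 <= t <= T -> 0 < T ->
  expR t <= 1 + t / T * expR T.
Proof.
move=> /andP[t0 tT] T0; have L0 : 0 <= t / T by rewrite divr_ge0 // ltW.
have L1 : t / T <= 1 by rewrite ler_pdivrMr // mul1r.
have A1 : expR t * (1 - t) <= 1.
  by rewrite -[leRHS](expRxMexpNx_1 t) ler_pM2l ?expR_gt0 // expR_ge1Dx.
have A2 : expR t * (1 + (T - t)) <= expR T.
  by rewrite -[X in _ <= expR X](subrKC t) expRD ler_pM2l ?expR_gt0 // expR_ge1Dx.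
have E : expR t = (1 - t / T) * (expR t * (1 - t)) + t / T * (expR t * (1 + (T - t))).
  by field; rewrite gt_eqF.
rewrite {1}E; apply: lerD; last by rewrite ler_wpM2l.
have : (1 - t / T) * (expR t * (1 - t)) <= (1 - t / T) * 1.
  by rewrite ler_wpM2l // subr_ge0.
lra.
Qed.

(** By convexity [q ^ sg <= 1 + (ln q / ln Y) * Y ^ sg] for [q <= Y], so the weak
    Mertens bound applies with no loss of a factor [ln Y]. *)
Lemma sum_prime_powR_le {R : realType} (sg : R) (Y : nat) : 0 < sg -> (1 < Y)%N ->
  \sum_(q < Y.+1 | prime q) q%:R `^ (- (1 - sg)) <=
  \sum_(q < Y.+1 | prime q) (q%:R : R)^-1 + 2 * Y%:R `^ sg.
Proof.
move=> sg0 Y1; have lnY : 0 < ln (Y%:R : R) by rewrite ln_gt0 // ltr1n.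
have Y0 : 0 < Y%:R :> R by rewrite ltr0n (ltn_trans _ Y1).
apply: (@le_trans _ _ (\sum_(q < Y.+1 | prime q)
    ((q%:R : R)^-1 + Y%:R `^ sg / ln Y%:R * (ln q%:R / q%:R)))).
  apply: ler_sum => q pq.
  have q0 : 0 < q%:R :> R by rewrite ltr0n prime_gt0.
  rewrite opprB addrC powRD ?(gt_eqF q0) ?implybT // powR_inv1 ?(ltW q0) //.
  have := @expR_chord_le R (sg * ln q%:R) (sg * ln Y%:R).
  rewrite mulr_gt0 // mulr_ge0 ?(ltW sg0) ?ln_ge0 ?ler1n ?prime_gt0 //=.
  rewrite ler_pM2l // ler_ln ?posrE // ler_nat -ltnS ltn_ord => /(_ isT isT).
  rewrite /powR (gt_eqF q0) (gt_eqF Y0) => H.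
  apply: le_trans (ler_wpM2l _ H) _; first by rewrite invr_ge0 ltW.
  rewrite le_eqVlt; apply/orP; left; apply/eqP; field.
  by rewrite !gt_eqF.
rewrite big_split lerD2l -mulr_sumr; apply: le_trans (ler_wpM2l _ (sum_ln_prime_le _ _)) _.
- by rewrite divr_ge0 ?powR_ge0 // ltW.
- exact: ltnW.
by rewrite [2 * ln _]mulrC mulrA divfK ?gt_eqF // mulrC.
Qed.

Lemma sum_prime_inv_le {R : realType} (d : R) : 0 < d ->
  exists2 C : R, 0 <= C & forall n, (0 < n)%N ->
    \sum_(p < n.+1 | prime p) (p%:R : R)^-1 <= C + d * ln n%:R.
Proof.
move=> d0; pose T : nat := (Num.truncn (expR (2 / d))).+1.
have lnT : 2 / d <= ln (T%:R : R).
  by rewrite -[leLHS]expRK ler_ln ?posrE ?expR_gt0 ?ltr0n // ltW // truncnS_gt.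
have lnT0 : 0 < ln (T%:R : R) by apply: lt_le_trans lnT; rewrite divr_gt0.
(* Primes up to T contribute at most T * sum_p p ^ (- 2) <= 2 * T; beyond T,
   1 / p <= (d / 2) * ln p / p since ln T >= 2 / d. *)
exists (2 * T%:R) => [|n n0]; first by rewrite mulr_ge0.
apply: (@le_trans _ _ (\sum_(p < n.+1 | prime p)
    (T%:R * p%:R `^ (- (1 + 1)) + d / 2 * (ln p%:R / p%:R)))).
  apply: ler_sum => p pp; have p0 : 0 < p%:R :> R by rewrite ltr0n prime_gt0.
  have lnp : 0 <= ln (p%:R : R) by rewrite ln_ge0 // ler1n prime_gt0.
  have p2 : p%:R `^ (- (1 + 1)) = p%:R^-1 * p%:R^-1 :> R.
    by rewrite (_ : 1 + 1 = 2%:R) // powR_invn ?ltW // expr2 invfM.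
  have [pT|Tp] := leP (p%:R : R) T%:R.
    rewrite ler_wpDr ?mulr_ge0 ?invr_ge0 ?(ltW d0) ?(ltW p0) //.
    by rewrite p2 mulrA ler_peMl ?invr_ge0 ?(ltW p0) // ler_pdivlMr // mul1r.
  rewrite ler_wpDl ?mulr_ge0 ?powR_ge0 // mulrA ler_peMl ?invr_ge0 ?(ltW p0) //.
  have : ln (T%:R : R) <= ln p%:R by rewrite ler_ln ?posrE // ?ltr0n // ltW.
  move=> /(le_trans lnT); rewrite ler_pdivrMr // => H; lra.
rewrite big_split /= -!mulr_sumr lerD //.
  rewrite mulrC ler_wpM2r //.
  have := @sum_powR_le R 1 n.+1 ltr01; rewrite invr1; move/(le_trans _); apply.
  rewrite [leLHS]big_mkcond [leRHS]big_mkcond; apply: ler_sum => p _.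
  by case: ifP => [/prime_gt0 ->|_] //; case: ifP => _ //; rewrite powR_ge0.
apply: le_trans (ler_wpM2l _ (sum_ln_prime_le _ n0)) _; first by rewrite divr_ge0 // ltW.
by rewrite mulrA divfK ?pnatr_eq0.
Qed.

(** * Sums over smooth integers *)

Lemma sum_smooth_inv_le {R : realType} (d : R) : 0 < d ->
  exists2 C : R, 0 < C & forall N p : nat, (0 < p)%N ->
    \sum_(m < N | smooth p m) (m%:R : R)^-1 <= C * p%:R `^ d.
Proof.
move=> d0; have [|C C0 HC] := @sum_prime_inv_le R (d / 4); first by rewrite divr_gt0.
exists (expR (4 * C)) => [|N p p0]; first exact: expR_gt0.
have inv_powR (m : nat) : (m%:R : R)^-1 = m%:R `^ (- 1) by rewrite powR_inv1.
under eq_bigr do rewrite inv_powR.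
apply: le_trans (sum_smooth_le _ _ _ _) _; first by lra.
have pR : 0 < p%:R :> R by rewrite ltr0n.
rewrite /powR [p%:R == 0]gt_eqF // -expRD ler_expR.
have -> : 4 * C + d * ln p%:R = 4 * (C + d / 4 * ln p%:R) by field.
rewrite ler_pM2l //; apply: le_trans (HC p p0).
by apply: ler_sum => q _; rewrite inv_powR.
Qed.

(** Rankin's trick: [1 / m <= x ^ (- sg) m ^ (sg - 1)] for [m > x]. *)
Lemma sum_smooth_tail_le {R : realType} (sg x : R) (N Y : nat) :
  0 < sg <= 1 / 2 -> (1 < Y)%N -> 0 < x ->
  \sum_(m < N | smooth Y m && (x < m%:R)) (m%:R : R)^-1 <=
  expR (- (sg * ln x) +
        4 * (\sum_(q < Y.+1 | prime q) (q%:R : R)^-1 + 2 * Y%:R `^ sg)).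
Proof.
move=> /andP[sg0 sg1] Y1 x0; rewrite expRD.
apply: (@le_trans _ _ (expR (- (sg * ln x)) *
    \sum_(m < N | smooth Y m) m%:R `^ (- (1 - sg)))); last first.
  rewrite ler_wpM2l ?expR_ge0 //.
  apply: le_trans (sum_smooth_le _ _ _ _) _; first by lra.
  by rewrite ler_expR ler_pM2l // sum_prime_powR_le.
rewrite mulr_sumr [leLHS]big_mkcond [leRHS]big_mkcond; apply: ler_sum => m _ /=.
case: ifP => [/andP[-> xm]|_]; last first.
  by case: ifP => _ //; rewrite mulr_ge0 ?expR_ge0 ?powR_ge0.
have m0 : 0 < m%:R :> R := lt_trans x0 xm.
have -> : expR (- (sg * ln x)) = x `^ (- sg) by rewrite /powR gt_eqF // mulNr.
have -> : - (1 - sg) = - 1 + sg by ring.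
rewrite powRD ?(gt_eqF m0) ?implybT // powR_inv1 ?(ltW m0) //.
rewrite mulrCA ler_peMr ?invr_ge0 ?(ltW m0) //.
rewrite powRN mulrC ler_pdivlMr ?powR_gt0 // mul1r.
by apply: ge0_ler_powR; rewrite ?nnegrE ?ltW.
Qed.

Lemma gcdn_le_sum {R : numDomainType} (k z : nat) : (0 < z)%N ->
  (gcdn k z)%:R <= \sum_(d <- divisors z | (d %| k)%N) d%:R :> R.
Proof.
move=> z0; rewrite big_mkcond (bigD1_seq (gcdn k z)) ?divisors_uniq //=.
  by rewrite dvdn_gcdl lerDl sumr_ge0 // => d _; case: ifP.
by rewrite -dvdn_divisors // dvdn_gcdr.
Qed.

(** Here [1 / lcm (k, z) = gcd (k, z) / (k z)], and the gcd is at most the sum of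
    the common divisors [d] of [k] and [z]; each [d] contributes at most the sum of
    the [1 / k']. *)
Lemma sum_smooth_inv_lcm_le {R : realType} (N Y z : nat) : (0 < z)%N ->
  \sum_(k < N | smooth Y k) ((lcmn k z)%:R : R)^-1 <=
  (tau z)%:R / z%:R * \sum_(k < N | smooth Y k) (k%:R : R)^-1.
Proof.
move=> z0; have zR : 0 < z%:R :> R by rewrite ltr0n.
apply: (@le_trans _ _ (\sum_(k < N | smooth Y k)
    \sum_(d <- divisors z | (d %| k)%N) z%:R^-1 * (d%:R / k%:R))).
  apply: ler_sum => k sk; have k0 : (0 < k)%N by case/andP: sk.
  have kR : 0 < k%:R :> R by rewrite ltr0n.
  rewrite -mulr_sumr -mulr_suml mulrCA -invfM [_ * k%:R]mulrC -natrM.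
  have -> : ((lcmn k z)%:R : R)^-1 = (gcdn k z)%:R / (k * z)%:R.
    rewrite -muln_lcm_gcd natrM invfM mulrCA divff ?mulr1 //.
    by rewrite pnatr_eq0 -lt0n gcdn_gt0 k0.
  by rewrite ler_wpM2r ?invr_ge0 // gcdn_le_sum.
rewrite (exchange_big_dep xpredT) //=.
set S := \sum_(k < N | smooth Y k) (k%:R : R)^-1.
apply: (@le_trans _ _ (\sum_(d <- divisors z) z%:R^-1 * S)); last first.
  by rewrite big_const_seq count_predT iter_addr_0 -mulrnAl mulr_natl.
rewrite !big_seq; apply: ler_sum => d; rewrite -dvdn_divisors // => dz.
have d0 : (0 < d)%N := dvdn_gt0 z0 dz.
rewrite -mulr_sumr ler_wpM2l ?invr_ge0 ?(ltW zR) //.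
rewrite (eq_bigl (fun k : 'I_N => (d %| k)%N && smooth Y k)); last first.
  by move=> k; rewrite andbC.
apply: le_trans (ler_sum_dvd _ _ _ (fun k => d%:R / k%:R) d0 _) _.
  by move=> k; rewrite divr_ge0.
rewrite /S [leLHS]big_mkcond [leRHS]big_mkcond; apply: ler_sum => k _ /=.
case: ifP => [/smooth_dvdM ->|_]; last by case: ifP => // _; rewrite invr_ge0.
by rewrite natrM invfM mulrA divff ?mul1r // pnatr_eq0 -lt0n.
Qed.

(** * Sums over primes weighted by the rank of appearance *)

(** The primes of rank [n] are distinct prime factors of [u n]. *)
Lemma card_rank_le {a1 a2 : int} {u : nat -> int} {B : nat} (N n : nat) :
  lucas_sequence a1 a2 u -> (forall n, `|u n| <= 2 ^ (B * n))%N -> u n != 0 ->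
  (#|[set p : 'I_N | [&& prime p, coprimez p%:Z a2 &
       rank_of_appearance u p == n]]%SET| <= B * n)%N.
Proof.
move=> Lu uB un0; rewrite cardE -(size_map val).
set s := map _ _; have us : (0 < `|u n|)%N by rewrite absz_gt0.
rewrite -(@leq_exp2l 2) //; apply: leq_trans (uB n).
apply: leq_trans (expn2_size_primes _ us); rewrite leq_exp2l //.
apply: uniq_leq_size; first by rewrite map_inj_uniq ?enum_uniq //; apply: val_inj.
move=> p; case/mapP => i; rewrite mem_enum inE => /and3P[pi ci /eqP zi] ->.
rewrite mem_primes pi us /=.
have [_ + _] := rank_of_appearanceP Lu (prime_gt0 pi) ci.
by rewrite zi dvdzE.
Qed.

(** The convergence that drives the estimate over integers with a large prime
    factor.  Up to constants, a prime with [z_u(p) ^ 2 > p] contributes at most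
    [p ^ (- 1.015)]; and at most [B * n] primes have rank [n], of which those with
    [n ^ 2 <= p] contribute at most [n ^ (- 2.03)] each. *)
Lemma sum_prime_rank_le {R : realType} {a1 a2 : int} {u : nat -> int} :
  lucas_sequence a1 a2 u -> (forall n, (0 < n)%N -> u n != 0) ->
  exists2 C : R, 0 < C & forall N : nat,
    \sum_(p < N | prime p && coprimez p%:Z a2)
       p%:R `^ (- (16 / 25)) *
         ((tau (rank_of_appearance u p))%:R / (rank_of_appearance u p)%:R) <= C.
Proof.
move=> Lu un0; have [B uB] := lucas_term_le Lu; have [T HT] := tau_le.
pose C1 : R := T%:R `^ (1 / 4).
pose e1 : R := 3 / 200; pose e2 : R := 3 / 100.
exists (1 + C1 * ((1 + e1^-1) + B%:R * (1 + e2^-1))) => [|N].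
  rewrite ltr_pwDl // mulr_ge0 ?powR_ge0 // addr_ge0 ?mulr_ge0 // ?addr_ge0 //;
    rewrite /e1 /e2; lra.
set z := rank_of_appearance u.
have zP (p : nat) : prime p && coprimez p%:Z a2 -> (0 < z p)%N.
  by move=> /andP[pp cp]; have [] := rank_of_appearanceP Lu (prime_gt0 pp) cp.
have tau_z (n : nat) : (0 < n)%N -> (tau n)%:R / n%:R <= C1 * n%:R `^ (- (3 / 4)).
  move=> n0; have nR : 0 < n%:R :> R by rewrite ltr0n.
  have tauE : (tau n)%:R = ((tau n)%:R ^+ 4) `^ (1 / 4) :> R.
    by rewrite -powR_mulrn // -powRrM (_ : 4%:R * (1 / 4) = 1) ?powRr1 //; field.
  have : (tau n)%:R <= (T%:R * n%:R) `^ (1 / 4) :> R.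
    rewrite tauE; apply: ge0_ler_powR; rewrite ?nnegrE ?exprn_ge0 ?mulr_ge0 //.
    by rewrite -natrX -natrM ler_nat HT.
  rewrite powRM // => H; rewrite ler_pdivrMr //; apply: le_trans H _.
  rewrite -mulrA ler_wpM2l ?powR_ge0 //.
  rewrite -[X in _ <= _ * X](powRr1 (ltW nR)) -powRD ?(gt_eqF nR) ?implybT //.
  by rewrite (_ : - (3 / 4) + 1 = 1 / 4 :> R) //; field.
apply: (@le_trans _ _ (C1 * (\sum_(p < N | prime p && coprimez p%:Z a2)
    (p%:R `^ (- (1 + e1)) +
     (if (z p ^ 2 <= p)%N then (z p)%:R `^ (- (2 + e2)) else 0))))).
  rewrite mulr_sumr; apply: ler_sum => p pP; have z0 := zP _ pP.
  have p0 : (0 < p)%N by case/andP: pP => /prime_gt0.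
  have zR : 0 < (z p)%:R :> R by rewrite ltr0n.
  have pR : 0 < p%:R :> R by rewrite ltr0n.
  apply: le_trans (ler_wpM2l (powR_ge0 _ _) (tau_z _ z0)) _.
  rewrite mulrCA ler_wpM2l ?powR_ge0 //.
  have [zp|zp] := leqP (z p ^ 2) p.
    rewrite ler_wpDl ?powR_ge0 //.
    have -> : - (2 + e2) = 2 * (- (16 / 25)) + - (3 / 4) by rewrite /e2; field.
    rewrite powRD ?(gt_eqF zR) ?implybT // ler_wpM2r ?powR_ge0 //.
    rewrite powRrM powR_mulrn ?(ltW zR) // !powRN.
    rewrite lef_pV2 ?posrE ?powR_gt0 ?exprn_gt0 //.
    apply: ge0_ler_powR; rewrite ?nnegrE ?exprn_ge0 ?(ltW zR) ?(ltW pR) //.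
    by rewrite -natrX ler_nat.
  rewrite addr0; have -> : - (1 + e1) = - (16 / 25) + - (3 / 8) by rewrite /e1; field.
  rewrite powRD ?(gt_eqF pR) ?implybT // ler_wpM2l ?powR_ge0 //.
  have -> : - (3 / 4) = 2 * - (3 / 8) :> R by field.
  rewrite powRrM powR_mulrn ?(ltW zR) // !powRN.
  rewrite lef_pV2 ?posrE ?powR_gt0 ?exprn_gt0 //.
  apply: ge0_ler_powR; rewrite ?nnegrE ?exprn_ge0 ?(ltW zR) ?(ltW pR) //.
  by rewrite -natrX ler_nat ltnW.
rewrite ler_wpDl // ler_wpM2l ?powR_ge0 // big_split lerD //=.
  apply: le_trans (sum_powR_le _ N _); last by rewrite /e1; lra.
  rewrite [leLHS]big_mkcond [leRHS]big_mkcond; apply: ler_sum => p _ /=.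
  case: ifP => [/andP[/prime_gt0 -> _]|_] //.
  by case: ifP => // _; rewrite powR_ge0.
rewrite -big_mkcondr /=.
rewrite (partition_big (fun p : 'I_N => inord (z p) : 'I_N.+1) (fun n => (0 < n)%N)) /=; last first.
  move=> p /andP[pP zp]; rewrite inordK ?zP // ltnS (leq_trans _ (ltnW (ltn_ord p))) //.
  by apply: leq_trans zp; rewrite expnS leq_pmulr // expn1 zP.
apply: (@le_trans _ _ (\sum_(n < N.+1 | (0 < n)%N) B%:R * n%:R `^ (- (1 + e2)))); last first.
  by rewrite -mulr_sumr ler_wpM2l // sum_powR_le // /e2; lra.
apply: ler_sum => n n0; have nR : 0 < n%:R :> R by rewrite ltr0n.
apply: (@le_trans _ _ (\sum_(p in [set p : 'I_N | [&& prime p, coprimez p%:Z a2 &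
       rank_of_appearance u p == n]]%SET) n%:R `^ (- (2 + e2)))).
  rewrite [leLHS]big_mkcond [leRHS]big_mkcond; apply: ler_sum => p _ /=.
  rewrite inE; case: ifP => [/andP[/andP[pP zp] /eqP zn]|_]; last first.
    by case: ifP => // _; rewrite powR_ge0.
  have <- : z p = n.
    rewrite -zn inordK // ltnS (leq_trans _ (ltnW (ltn_ord p))) //.
    by apply: leq_trans zp; rewrite expnS leq_pmulr // expn1 zP.
  by rewrite eqxx andbT pP.
rewrite sumr_const -[_ *+ #|_|]mulr_natl.
apply: (@le_trans _ _ ((B * n)%:R * n%:R `^ (- (2 + e2)))).
  by rewrite ler_wpM2r ?powR_ge0 // ler_nat (card_rank_le _ _ Lu uB) // un0.
rewrite natrM -mulrA ler_wpM2l //.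
rewrite -{1}(powRr1 (ltW nR)) -powRD ?(gt_eqF nR) ?implybT //.
by rewrite (_ : 1 - (2 + e2) = - (1 + e2)) //; ring.
Qed.

(** * Splitting by the largest prime factor *)

(** The sum over the integers whose largest prime factor exceeds [Y]; here
    [p ^ (- 1 + 1 / 100) <= y ^ (- 7 / 20) * p ^ (- 16 / 25)]. *)
Lemma sum_large_prime_le {R : realType} {a1 a2 : int} {u : nat -> int} :
  lucas_sequence a1 a2 u -> lucas_discriminant a1 a2 != 0 ->
  (forall n, (0 < n)%N -> u n != 0) ->
  exists2 C : R, 0 < C & forall (N Y : nat) (y : R),
    (`|lucas_discriminant a1 a2| <= Y)%N -> 0 < y -> y <= Y.+1%:R ->
    \sum_(m < N | [&& (0 < m)%N, coprimez m%:Z a2 & (Y < max_pdiv m)%N])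
      ((ell_u u m)%:R : R)^-1 <= C * y `^ (- (7 / 20)).
Proof.
move=> Lu D0 un0.
have [C1 C1_gt0 H1] := @sum_smooth_inv_le R (1 / 100) ltac:(lra).
have [C2 C2_gt0 H2] := @sum_prime_rank_le R _ _ _ Lu un0.
exists (C1 * C2) => [|N Y y DY y0 yY]; first exact: mulr_gt0.
set z := rank_of_appearance u.
have Y0 : (0 < Y)%N by apply: leq_trans DY; rewrite absz_gt0.
pose good (p : nat) := [&& prime p, coprimez p%:Z a2 & (Y < p)%N].
pose G (pk : 'I_N.+1 * 'I_N.+1) : R := pk.1%:R^-1 * (lcmn pk.2 (z pk.1))%:R^-1.
have G0 pk : 0 <= G pk by rewrite mulr_ge0 ?invr_ge0.
have ltp (m : 'I_N) : (0 < m)%N -> (max_pdiv m < N.+1)%N.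
  by move=> m0; rewrite ltnS (leq_trans (max_pdiv_leq m0)) // ltnW.
have ltk (m : 'I_N) : (m %/ max_pdiv m < N.+1)%N.
  by rewrite ltnS (leq_trans (leq_div _ _)) // ltnW.
(* Reindex by the pair of the largest prime factor p and the cofactor m %/ p. *)
apply: (@le_trans _ _ (\sum_(pk : 'I_N.+1 * 'I_N.+1 |
    good pk.1 && smooth pk.1 pk.2) G pk)).
  apply: (@ler_sum_inj _ _ _
    (fun m : 'I_N => (inord (max_pdiv m), inord (m %/ max_pdiv m)))) => //.
    move=> m n /and3P[m0 _ _] /and3P[n0 _ _] [] /(congr1 val) /= + /(congr1 val) /=.
    rewrite !inordK ?ltp ?ltk // => pE kE.
    apply/val_inj; rewrite /= -(divnK (max_pdiv_dvd m)) -(divnK (max_pdiv_dvd n)).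
    by rewrite kE pE.
  move=> m /and3P[m0 cm Ym]; rewrite /G /=.
  rewrite !inordK ?ltp ?ltk //.
  set p := max_pdiv m in Ym *.
  have m1 : (1 < m)%N by rewrite (leq_trans _ (max_pdiv_leq m0)) // (leq_ltn_trans Y0).
  have pp : prime p := max_pdiv_prime m1.
  have pm : (p %| m)%N := max_pdiv_dvd m.
  have cp : coprimez p%:Z a2 by move: cm; rewrite !coprimezE; apply: coprime_dvdl.
  have pD : ~~ (p%:Z %| lucas_discriminant a1 a2)%Z.
    rewrite dvdzE; apply/negP => /dvdn_leq; rewrite absz_gt0 => /(_ D0) /=.
    by rewrite leqNgt (leq_ltn_trans DY).
  rewrite /good pp cp Ym /=; apply/andP; split.
    apply/andP; split; first by rewrite divn_gt0 ?prime_gt0 // dvdn_leq.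
    apply/allP => q qk; rewrite inE; apply: max_pdiv_max.
    move: qk; rewrite !mem_primes => /and3P[-> _ qk] /=.
    by rewrite m0 (dvdn_trans qk) // dvdn_div.
  have [z0 _ _] := rank_of_appearanceP Lu (prime_gt0 pp) cp.
  have k0 : (0 < m %/ p)%N by rewrite divn_gt0 ?prime_gt0 // dvdn_leq.
  have cpz : coprime p (z p).
    by rewrite prime_coprime // (rank_of_appearance_coprime Lu pp cp pD).
  have [zm0 _ _] := rank_of_appearanceP Lu m0 cm.
  rewrite -invfM -natrM lef_pV2 ?posrE ?ltr0n ?muln_gt0 ?lcmn_gt0 ?(prime_gt0 pp) ?k0 ?z0 ?m0 ?zm0 //.
    rewrite ler_nat; apply: leq_trans (ell_u_ge_lcm Lu pp m0 pm cm).
    apply: dvdn_leq; first by rewrite lcmn_gt0 m0.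
    rewrite muln_lcmr mulnC divnK // dvdn_lcm dvdn_lcml /=.
    by rewrite Gauss_dvd // dvdn_lcmr andbT (dvdn_trans pm) // dvdn_lcml.
have -> : \sum_(pk : 'I_N.+1 * 'I_N.+1 | good pk.1 && smooth pk.1 pk.2) G pk =
    \sum_(p < N.+1 | good p) \sum_(k < N.+1 | smooth p k) G (p, k).
  by rewrite pair_big_dep /=; apply: eq_bigr => -[].
apply: (@le_trans _ _ (\sum_(p < N.+1 | prime p && coprimez p%:Z a2)
   C1 * y `^ (- (7 / 20)) * (p%:R `^ (- (16 / 25)) * ((tau (z p))%:R / (z p)%:R)))).
  rewrite [leLHS]big_mkcond [leRHS]big_mkcond; apply: ler_sum => p _ /=.
  case: ifP => [/and3P[pp cp Yp]|_]; last first.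
    case: ifP => // _; rewrite !mulr_ge0 ?powR_ge0 ?invr_ge0 //; exact: ltW.
  rewrite pp cp /= /G /= -mulr_sumr.
  have [z0 _ _] := rank_of_appearanceP Lu (prime_gt0 pp) cp.
  have pR : 0 < p%:R :> R by rewrite ltr0n prime_gt0.
  apply: le_trans (ler_wpM2l _ (sum_smooth_inv_lcm_le _ _ _ z0)) _.
    by rewrite invr_ge0 ltW.
  set t := _%:R / _%:R; have t0 : 0 <= t by rewrite divr_ge0.
  apply: le_trans (ler_wpM2l _ (ler_wpM2l t0 (H1 _ _ (prime_gt0 pp)))) _.
    by rewrite invr_ge0 ltW.
  have -> : p%:R^-1 * (t * (C1 * p%:R `^ (1 / 100))) =
     C1 * (p%:R^-1 * p%:R `^ (1 / 100)) * t by ring.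
  rewrite mulrA ler_wpM2r // -[leRHS]mulrA ler_wpM2l ?(ltW C1_gt0) //.
  rewrite -powR_inv1 ?(ltW pR) // -powRD ?(gt_eqF pR) ?implybT //.
  have -> : -1 + 1 / 100 = - (7 / 20) + - (16 / 25) :> R by field.
  rewrite powRD ?(gt_eqF pR) ?implybT // ler_wpM2r ?powR_ge0 // !powRN.
  rewrite lef_pV2 ?posrE ?powR_gt0 //; apply: ge0_ler_powR; rewrite ?nnegrE ?(ltW y0) //.
  by apply: le_trans yY _; rewrite ler_nat.
rewrite -mulr_sumr [leRHS]mulrAC ler_wpM2l //.
by rewrite mulr_ge0 ?powR_ge0 // ltW.
Qed.

(** * The asymptotic estimate *)

(** The scale [L x = sqrt (ln x * ln (ln x))] of the estimate. *)
Definition Lscale {R : realType} (x : R) : R := Num.sqrt (ln x * ln (ln x)).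

(** For large [x] the scale [L x] dominates [sqrt (ln x)].  The exponent
    [sg = ln (ln x) / (2.4 * L x)] of Rankin's trick is the one that makes
    [y ^ sg = sqrt (ln x)] for [y = exp (1.2 * L x)]. *)
Lemma Lscale_large {R : realType} (A x : R) : 2 <= A -> expR (expR (A ^+ 2)) <= x ->
  [/\ 0 < x, 1 <= Num.sqrt (ln x), A <= Lscale x, A * Num.sqrt (ln x) <= Lscale x
    & exists sg, [/\ 0 < sg <= 1 / 2, sg * ln x = 5 / 12 * Lscale x
        & expR (sg * (6 / 5 * Lscale x)) = Num.sqrt (ln x)]].
Proof.
move=> A2 Xx.
have x0 : 0 < x by apply: lt_le_trans Xx; apply: expR_gt0.
have l_ge : expR (A ^+ 2) <= ln x.
  by rewrite -[leLHS]expRK ler_ln ?posrE ?expR_gt0.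
have l0 : 0 < ln x by apply: lt_le_trans l_ge; apply: expR_gt0.
have w_ge : A ^+ 2 <= ln (ln x).
  by rewrite -[leLHS]expRK ler_ln ?posrE ?expR_gt0.
have ll0 : 0 <= ln (ln x) by apply: le_trans w_ge; apply: sqr_ge0.
have rE : Num.sqrt (ln x) * Num.sqrt (ln x) = ln x by rewrite -expr2 sqr_sqrtr // ltW.
have wE : Num.sqrt (ln (ln x)) * Num.sqrt (ln (ln x)) = ln (ln x).
  by rewrite -expr2 sqr_sqrtr.
have LE : Lscale x = Num.sqrt (ln x) * Num.sqrt (ln (ln x)).
  by rewrite /Lscale sqrtrM // ltW.
have Aw : A <= Num.sqrt (ln (ln x)).
  by rewrite -[leLHS]ger0_norm -?sqrtr_sqr ?ler_wsqrtr //; lra.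
have wr : Num.sqrt (ln (ln x)) <= Num.sqrt (ln x).
  by rewrite ler_wsqrtr // ltW // ln_sublinear.
have lnr : ln (Num.sqrt (ln x)) = ln (ln x) / 2.
  by rewrite -[in RHS]rE lnM ?posrE ?sqrtr_gt0 //; field.
move: {Xx l_ge w_ge} rE wE LE Aw wr lnr; move: (Num.sqrt (ln x)) => r.
move: (Num.sqrt (ln (ln x))) (Lscale x) => w L rE wE LE Aw wr lnr.
have rL : A * r <= L by rewrite LE mulrC ler_wpM2l //; lra.
have r1 : 1 <= r by lra.
have AL : A <= L by apply: le_trans rL; rewrite ler_peMr //; lra.
split=> //; exists (ln (ln x) / (12 / 5 * L)).
have L0 : 0 < L by lra.
have w0 : 0 < w by lra.
have r0 : 0 < r by lra.
rewrite -wE LE; split.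
- have -> : w * w / (12 / 5 * (r * w)) = 5 / 12 * (w / r) by field; rewrite !gt_eqF.
  have q0 : 0 < w / r by rewrite divr_gt0.
  have q1 : w / r <= 1 by rewrite ler_pdivrMr // mul1r.
  by apply/andP; split; lra.
- by rewrite -rE; field; rewrite !gt_eqF.
- have -> : w * w / (12 / 5 * (r * w)) * (6 / 5 * (r * w)) = ln r.
    by rewrite lnr -wE; field; rewrite !gt_eqF.
  by rewrite lnK // posrE.
Qed.

Lemma sum_inv_ell_split {R : realType} {a1 a2 : int} {u : nat -> int}
    (x : R) (N Y : nat) : lucas_sequence a1 a2 u ->
  \sum_(m < N | [&& (0 < m)%N, x < m%:R & coprimez m%:Z a2])
    ((ell_u u m)%:R : R)^-1 <=
  \sum_(m < N | smooth Y m && (x < m%:R)) (m%:R : R)^-1 +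
  \sum_(m < N | [&& (0 < m)%N, coprimez m%:Z a2 & (Y < max_pdiv m)%N])
    ((ell_u u m)%:R : R)^-1.
Proof.
move=> Lu.
rewrite [X in _ <= X + _]big_mkcond [X in _ <= _ + X]big_mkcond [leLHS]big_mkcond.
rewrite -big_split; apply: ler_sum => m _ /=.
have small0 : 0 <= (if smooth Y m && (x < m%:R) then (m%:R : R)^-1 else 0).
  by case: ifP; rewrite ?invr_ge0.
case: ifP => [/and3P[m0 xm cm]|_]; last first.
  by rewrite addr_ge0 //; case: ifP; rewrite ?invr_ge0.
rewrite m0 cm /=; case: ltnP => mY; first by rewrite ler_wpDl.
have -> : smooth Y m.
  rewrite /smooth /pnat m0; apply/allP => q qm; rewrite inE.
  by apply: leq_trans mY; apply: max_pdiv_max.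
have [z0 _ _] := rank_of_appearanceP Lu m0 cm.
rewrite xm /= addr0 lef_pV2 ?posrE ?ltr0n ?ler_nat //; last by rewrite lcmn_gt0 m0.
by apply: dvdn_leq; rewrite ?dvdn_lcml // lcmn_gt0 m0.
Qed.

(** The estimate with the explicit rate [0.41], for [x] large in terms of [u]. *)
Lemma sum_inv_ell_le {R : realType} {a1 a2 : int} {u : nat -> int} :
  lucas_sequence a1 a2 u -> lucas_discriminant a1 a2 != 0 ->
  (forall n, (0 < n)%N -> u n != 0) ->
  exists X : R, forall x, X <= x -> forall N : nat,
    \sum_(m < N | [&& (0 < m)%N, x < m%:R & coprimez m%:Z a2])
      ((ell_u u m)%:R : R)^-1 <= expR (- (41 / 100 * Lscale x)).
Proof.
move=> Lu D0 un0.
(* The density 1 / 4800 costs 4 * (6 / 5) / 4800 = 1 / 1000 in the exponent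
   - 5 / 12 of the smooth part; the terms of order sqrt (ln x) cost 1 / 250. *)
have [C C0 HC] := @sum_prime_inv_le R (1 / 4800) ltac:(lra).
have [K K0 HK] := @sum_large_prime_le R _ _ _ Lu D0 un0.
pose D := `|lucas_discriminant a1 a2|%N.
have [A [A2 AD AC AK]] : exists A : R, [/\ 2 <= A, D%:R + 2 <= A,
    250 * (8 + 4 * C) <= A & 1000 * K <= A].
  exists (2 + D%:R + 250 * (8 + 4 * C) + 1000 * K).
  by have : 0 <= D%:R :> R by []; clear -C0 K0; split; lra.
exists (expR (expR (A ^+ 2))) => x Xx N.
have [x0 r1 AL rL [sg [/andP[sg0 sg1] sgl sgL]]] := Lscale_large A x A2 Xx.
move: r1 AL rL sgl sgL; move: (Num.sqrt (ln x)) (Lscale x) => r L r1 AL rL sgl sgL.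
pose y := expR (6 / 5 * L); pose Y := Num.truncn y.
have /andP[Yy yY] : (Y%:R <= y < Y.+1%:R) by apply: truncn_itv; apply: expR_ge0.
have DY : (D < Y)%N.
  rewrite -ltnS -(ltr_nat R); apply: le_lt_trans yY.
  apply: le_trans (expR_ge1Dx _); rewrite -addn1 natrD.
  by clear -A2 AL AD; lra.
have Y1 : (1 < Y)%N by apply: leq_ltn_trans DY; rewrite /D absz_gt0.
have YR : 0 < Y%:R :> R by rewrite ltr0n (ltn_trans _ Y1).
have lnY : ln Y%:R <= 6 / 5 * L.
  by rewrite -[leRHS]expRK ler_ln ?posrE ?expR_gt0.
have Ysg : Y%:R `^ sg <= r.
  by rewrite /powR gt_eqF // -sgL ler_expR ler_wpM2l // ltW.
have small : \sum_(m < N | smooth Y m && (x < m%:R)) (m%:R : R)^-1 <=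
    expR (- (411 / 1000 * L)).
  apply: le_trans (sum_smooth_tail_le sg _ _ _ _ Y1 x0) _; first by rewrite sg0.
  rewrite ler_expR sgl; have := HC Y (ltnW Y1).
  have : 250 * (8 + 4 * C) * r <= L.
    by apply: le_trans rL; rewrite ler_wpM2r // (le_trans ler01).
  have : C <= C * r by rewrite ler_peMr.
  by clear -Ysg lnY A2 AL; lra.
have large : \sum_(m < N | [&& (0 < m)%N, coprimez m%:Z a2 & (Y < max_pdiv m)%N])
    ((ell_u u m)%:R : R)^-1 <= K * expR (- (42 / 100 * L)).
  have -> : - (42 / 100 * L) = (6 / 5 * L) * - (7 / 20) by field.
  by rewrite expRM; apply: (HK N Y _ (ltnW DY) (expR_gt0 _) (ltW yY)).
apply: le_trans (sum_inv_ell_split x N Y Lu) (le_trans (lerD small large) _).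
clear -A2 AL AK K0.
have E1 : expR (- (42 / 100 * L)) <= expR (- (411 / 1000 * L)) by rewrite ler_expR; lra.
apply: (@le_trans _ _ ((1 + K) * expR (- (411 / 1000 * L)))).
  by have := ler_wpM2l (ltW K0) E1; lra.
have -> : - (41 / 100 * L) = L / 1000 + - (411 / 1000 * L) by field.
rewrite expRD ler_wpM2r ?expR_ge0 //; apply: le_trans (expR_ge1Dx _); lra.
Qed.

Lemma nneseries_le {R : realType} (P : pred nat) (f : nat -> R) (b : R) :
  (forall m, 0 <= f m) -> (forall N : nat, \sum_(m < N | P m) f m <= b) ->
  (\sum_(m <oo | P m) (f m)%:E <= b%:E)%E.
Proof.
move=> f0 fb; apply: lime_le.
  by apply: is_cvg_nneseries_cond => m _ _; rewrite lee_fin.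
by near=> N; rewrite sumEFin lee_fin big_mkord.
Unshelve. all: by end_near.
Qed.

Theorem proposition1p4 (R : realType) :
  exists x0 : R -> R,
  forall (a1 a2 : int) (u : nat -> int),
    lucas_sequence a1 a2 u ->
    lucas_nondegenerate R a1 a2 ->
    lucas_discriminant a1 a2 != 0 ->
    exists2 o : R -> R, o x @[x --> +oo] --> (0 : R) &
      forall eps : R, 0 < eps -> forall x : R, x0 eps <= x ->
        (\sum_(m <oo | [&& (0 < m)%N, (x < m%:R)%R & coprimez m%:Z a2])
            ((ell_u u m)%:R^-1)%:E
          <= (expR (- ((Num.sqrt 6)^-1 - eps + o x)
                    * Num.sqrt (ln x * ln (ln x))))%:E)%E.
Proof.
(* Any x0 that makes L x positive will do. *)
exists (fun=> expR 2) => a1 a2 u Lu nd D0.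
have un0 n : (0 < n)%N -> u n != 0 by apply: (lucas_term_neq0 _ Lu nd D0).
have [X HX] := @sum_inv_ell_le R _ _ _ Lu D0 un0.
have sqrt6 : (Num.sqrt 6)^-1 <= 41 / 100 :> R.
  have h : 100 / 41 <= Num.sqrt (6 : R).
    by rewrite -(@ler_pXn2r _ 2) ?nnegrE ?sqrtr_ge0 // ?sqr_sqrtr //; lra.
  by apply: le_trans (_ : (100 / 41)^-1 <= _); [rewrite lef_pV2 ?posrE //; lra | lra].
(* B bounds the sum for every x < X: the terms with m <= X number at most M.+1,
   and the others sum to at most 1. *)
pose M := (Num.truncn X).+1.
pose B : R := 1 + M.+1%:R.
have B1 : 1 <= B by rewrite lerDl.
(* For x < X the value makes the right-hand side equal to exp (eps * L x) * B. *)
exists (fun x => if X <= x then 0 else - (Num.sqrt 6)^-1 - ln B / Lscale x).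
  apply: cvg_near_cst; near=> x.
  by have -> : X <= x by near: x; apply: nbhs_pinfty_ge; rewrite num_real.
move=> eps eps0 x x_ge; rewrite -/(Lscale x).
have lnx : 2 <= ln x.
  by rewrite -[leLHS]expRK ler_ln ?posrE ?expR_gt0 // (lt_le_trans _ x_ge) ?expR_gt0.
have L0 : 0 < Lscale x.
  by rewrite sqrtr_gt0; apply: mulr_gt0; [lra | apply: ln_gt0; lra].
apply: nneseries_le => [m|N]; first by rewrite invr_ge0.
case: ifP => [Xx|/negbT]; last first.
  rewrite -ltNge => xX.
  have -> : - ((Num.sqrt 6)^-1 - eps + (- (Num.sqrt 6)^-1 - ln B / Lscale x)) *
      Lscale x = eps * Lscale x + ln B.
    by field; rewrite (gt_eqF L0) gt_eqF ?sqrtr_gt0.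
  apply: (@le_trans _ _ B); last first.
    have Bpos : B \is Num.pos by rewrite posrE (lt_le_trans ltr01).
    by rewrite -[leLHS](lnK Bpos) ler_expR lerDr mulr_ge0 // ltW.
  have S1 : \sum_(m < N | [&& (0 < m)%N, X < m%:R & coprimez m%:Z a2])
      ((ell_u u m)%:R : R)^-1 <= 1.
    apply: le_trans (HX X (lexx _) N) _.
    by rewrite expR_le1 oppr_le0 mulr_ge0 ?sqrtr_ge0 //; lra.
  have S2 : \sum_(m < N | m%:R <= X) (1 : R) <= M.+1%:R.
    have -> : M.+1%:R = \sum_(j < M.+1) (1 : R) by rewrite sumr_const card_ord.
    have mM (m : 'I_N) : m%:R <= X -> (m < M.+1)%N.
      by move=> mX; rewrite -(ltr_nat R) (le_lt_trans mX) // (lt_trans (truncnS_gt X)) // ltr_nat.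
    apply: (@ler_sum_inj _ _ _ (fun m : 'I_N => inord m : 'I_M.+1)) => //=.
      move=> m n mX nX /(congr1 val) /=; rewrite !inordK ?mM // => mn.
      exact/val_inj.
  apply: le_trans (lerD S1 S2).
  rewrite [X in _ <= X + _]big_mkcond [X in _ <= _ + X]big_mkcond [leLHS]big_mkcond.
  rewrite -big_split; apply: ler_sum => m _ /=.
  have inv1 : ((ell_u u m)%:R : R)^-1 <= 1.
    by case: (ell_u u m) => [|k]; rewrite ?invr0 // invf_le1 ?ltr0n // ler1n.
  have inv0 : 0 <= ((ell_u u m)%:R : R)^-1 by rewrite invr_ge0.
  case: (leP m%:R X) => mX; last by rewrite addr0; case: ifP => [/and3P[-> _ ->]|_] //; case: ifP.
  rewrite andbF add0r; case: ifP => _ //.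
apply: le_trans (HX x Xx N) _; rewrite ler_expR addr0 mulNr lerN2 ler_wpM2r ?sqrtr_ge0 //.
lra.
Unshelve. all: by end_near.
Qed.
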